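(* Let $k\in\mathbb C$, $k\ne0,-1$, $p\in\mathbb C$, $r\in\mathbb N$, $r\ge1$. The singular vector $|\mathrm{MFF}^-(r,1,p,k)\rangle=(E^{12}_{-1})^r\,|p,-\frac r2+\frac{k+1}2,k\rangle$ of affine $s\ell(2|1)$, mapped to the Ramond sector and evaluated in the realization of $s\ell(2|1)$ given in the context, i.e. $(E^{12}_{-1})^r$ applied to the Ramond highest-weight state $$|p,j,k;\tfrac12\rangle=|k-2p,l,k\rangle_{N=2}\otimes|e^{\frac{2j}k(U-F)}\rangle\otimes|0\rangle_{\psi\bar\psi},\qquad j=\frac{k+1-r}2,\quad l=-\frac{(j+p-\frac k2)(1-j+\frac k2+p)}{1+k},$$ becomes $$|\mathrm{MFF}^-(r,1,p,k)\rangle^{(R)}=\Bigl|k-2p,\ \tfrac1{k+1}\bigl(\tfrac{r-1}2-p\bigr)\bigl(\tfrac{r+1}2+p\bigr),\ k\Bigr\rangle_{N=2}\otimes\bigl|e^{\frac{r+k+1}k(U-F)}\bigr\rangle\otimes|0\rangle_{\psi\bar\psi}.$$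
   Context: Affine $s\ell(2|1)$ of level $k$ is realized by tensoring an $N=2$ superconformal algebra of central charge $-3-6k$ with free fields $\partial F,\partial U,\psi,\bar\psi$ satisfying $\partial F(z)\partial F(w)\sim\frac{-k/2}{(z-w)^2}$, $\partial U(z)\partial U(w)\sim\frac{k/2}{(z-w)^2}$, $\psi(z)\bar\psi(w)\sim\frac1{z-w}$ (other products trivial). In this realization $E^{12}(z)=\sum_{n\in\mathbb Z}E^{12}_nz^{-n-1}=e^{\frac2k(U-F)}(z)$; this current is unaffected by the spectral flow to the Ramond sector. $|e^{a(U-F)}\rangle$ is the Fock vacuum created by the vertex operator $e^{a(U-F)}$: annihilated by the positive modes of $\partial F$ and $\partial U$, with zero modes $(\partial U)_0=(\partial F)_0=ka/2$; vertex operators $e^{b(U-F)}(z)$ act between these Fock modules shifting $a\to a+b$. $|h,\ell,k\rangle_{N=2}$ is the highest-weight vector of the $N=2$ Verma module with $U(1)$ charge $\mathcal H_0=h$ and dimension $\mathcal L_0=\ell$ (annihilated by $\mathcal Q_{\ge1},\mathcal G_{\ge0},\mathcal L_{\ge1},\mathcal H_{\ge1}$ in the twisted $N=2$ algebra). $|0\rangle_{\psi\bar\psi}$ is annihilated by $\psi_{\ge1}$ and $\bar\psi_{\ge0}$ for $\psi(z)=\sum_{n\in\mathbb Z}\psi_nz^{-n}$, $\bar\psi(z)=\sum_{n\in\mathbb Z}\bar\psi_nz^{-n-1}$. *)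

(* Defs.v *)
From HB Require Import structures.
From mathcomp Require Import all_boot all_order all_algebra.
From mathcomp Require Import finmap monalg.
From mathcomp Require Import boolp classical_sets fsbigop reals.
From mathcomp Require Import complex.

Set Implicit Arguments.
Unset Strict Implicit.
Unset Printing Implicit Defensive.

Import GRing.Theory.
Local Open Scope ring_scope.
Local Open Scope quotient_scope.

Section Quotient.
Variables (A : nzRingType) (V : lmodType A).

Definition in_span (X : V -> Prop) (v : V) : Prop :=
  forall P : V -> Prop, P 0 ->
    (forall a u w, P u -> P w -> P (a *: u + w)) ->
    (forall x, X x -> P x) -> P v.

Definition span_pred (X : V -> Prop) : V -> bool := fun v => `[< in_span X v >].

Lemma span_submod (X : V -> Prop) : submod_closed (span_pred X).
Proof.
split=> [|a u v /asboolP hu /asboolP hv]; apply/asboolP => P P0 Pl PX //.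
by apply: (Pl); [apply: hu | apply: hv].
Qed.

HB.instance Definition _ (X : V -> Prop) :=
  GRing.isZmodClosed.Build V (span_pred X)
    (GRing.submod_closedB (span_submod X)).
HB.instance Definition _ (X : V -> Prop) :=
  GRing.isScaleClosed.Build A V (span_pred X)
    (GRing.subsemimod_closedZ (GRing.submod_closed_semi (span_submod X))).

Definition span_closed (X : V -> Prop) : zmodClosed V :=
  GRing.ZmodClosed.clone V (span_pred X) _.

Lemma span_gen (X : V -> Prop) x : X x -> x \in span_pred X.
Proof. by move=> Xx; apply/asboolP => P _ _; apply. Qed.

Variable X : V -> Prop.

Definition lquot : Type := Quotient.quot (span_closed X).

HB.instance Definition _ := GRing.Zmodule.on lquot.

Definition lpi (v : V) : lquot := \pi_(Quotient.quot (span_closed X)) v.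
Definition lrepr (x : lquot) : V := repr x.

Lemma lreprK x : lpi (lrepr x) = x.
Proof. exact: reprK. Qed.

Lemma lpi_eqP u v : reflect (lpi u = lpi v) (u - v \in span_pred X).
Proof. by rewrite Quotient.idealrBE; apply: eqP. Qed.

Lemma lpiD u v : lpi (u + v) = lpi u + lpi v.
Proof. by rewrite /lpi !piE. Qed.

Lemma lpi0 : lpi 0 = 0.
Proof. by rewrite /lpi !piE. Qed.

Definition lquot_scale (a : A) (x : lquot) : lquot := lpi (a *: lrepr x).

Lemma lquot_scaleE a v : lquot_scale a (lpi v) = lpi (a *: v).
Proof.
apply/lpi_eqP; rewrite -scalerBr rpredZ //.
by apply/lpi_eqP; rewrite lreprK.
Qed.

Lemma lquot_scaleA a b x : lquot_scale a (lquot_scale b x) = lquot_scale (a * b) x.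
Proof. by rewrite -[x]lreprK !lquot_scaleE scalerA. Qed.

Lemma lquot_scale1 : left_id 1 lquot_scale.
Proof. by move=> x; rewrite -[x]lreprK lquot_scaleE scale1r. Qed.

Lemma lquot_scaleDr : right_distributive lquot_scale +%R.
Proof.
move=> a x y; rewrite -[x]lreprK -[y]lreprK -lpiD !lquot_scaleE.
by rewrite scalerDr lpiD.
Qed.

Lemma lquot_scaleDl x : {morph lquot_scale^~ x : a b / a + b}.
Proof. by move=> a b; rewrite /= -[x]lreprK !lquot_scaleE scalerDl lpiD. Qed.

HB.instance Definition _ := GRing.Zmodule_isLmodule.Build A lquot
  lquot_scaleA lquot_scale1 lquot_scaleDr lquot_scaleDl.

Lemma lpi_is_linear : linear lpi.
Proof. by move=> a u v; rewrite lpiD -lquot_scaleE. Qed.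

HB.instance Definition _ := GRing.isLinear.Build A V lquot _ lpi lpi_is_linear.

Lemma lpi_rel x : X x -> lpi x = 0.
Proof. by move=> Xx; rewrite -lpi0; apply/lpi_eqP; rewrite subr0 span_gen. Qed.

Section Lift.
Variables (W : lmodType A) (f : {linear V -> W}).
Hypothesis fX : forall x, X x -> f x = 0.

Definition lquot_lift (x : lquot) : W := f (lrepr x).

Lemma lquot_liftE v : lquot_lift (lpi v) = f v.
Proof.
apply/eqP; rewrite -subr_eq0 -raddfB; apply/eqP.
have : lrepr (lpi v) - v \in span_pred X by apply/lpi_eqP; rewrite lreprK.
move/asboolP/(_ (fun z => f z = 0)); apply=> // [|a u w fu fw].
  exact: raddf0.
by rewrite linearP fu fw scaler0 addr0.
Qed.

Lemma lquot_lift_is_linear : linear lquot_lift.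
Proof.
by move=> a x y; rewrite -[x]lreprK -[y]lreprK -linearP !lquot_liftE linearP.
Qed.
End Lift.
End Quotient.

(* The free K-module on B.  Basis vectors and linear extensions are locked:
   unification must not unfold them down to finitely supported maps. *)
Definition fmod (K : comNzRingType) (B : choiceType) : lmodType K := {malg K[B]}.

Definition fbas (K : comNzRingType) (B : choiceType) (b : B) : fmod K B :=
  locked (<< b >> : {malg K[B]}).

Section FreeModule.
Variables (K : comNzRingType) (B : choiceType) (W : lmodType K).
Variable f : B -> W.

Let ext (g : {malg K[B]}) : W := \sum_(b <- msupp g) g@_b *: f b.

Definition lin_ext : fmod K B -> W := locked ext.

Let extEw (d : {fset B}) g :
  (msupp g `<=` d)%fset -> ext g = \sum_(b <- d) g@_b *: f b.
Proof.
move=> sd; rewrite /ext (big_fset_incl _ sd) // => b _ nb.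
by rewrite mcoeff_outdom // scale0r.
Qed.

Lemma lin_ext_is_linear : linear lin_ext.
Proof.
rewrite /lin_ext -lock => a g h.
pose d := (msupp g `|` msupp h `|` msupp (a *: g + h))%fset.
have s1 : (msupp g `<=` d)%fset.
  by rewrite /d -fsetUA fsubsetUl.
have s2 : (msupp h `<=` d)%fset.
  by rewrite /d (fsetUC (msupp g)) -fsetUA fsubsetUl.
have s3 : (msupp (a *: g + h) `<=` d)%fset by rewrite fsubsetUr.
rewrite (extEw s1) (extEw s2) (extEw s3) scaler_sumr -big_split /=.
by apply: eq_bigr => b _; rewrite mcoeffD mcoeffZ scalerDl scalerA.
Qed.

HB.instance Definition _ :=
  GRing.isLinear.Build K (fmod K B) W _ lin_ext lin_ext_is_linear.

Lemma lin_extU b : lin_ext (fbas K b) = f b.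
Proof.
rewrite /lin_ext /fbas -!lock /ext.
by rewrite msuppU oner_eq0 big_seq_fset1 mcoeffUU scale1r.
Qed.

Lemma eq_linear_basis (u v : {linear fmod K B -> W}) :
  (forall b, u (fbas K b) = v (fbas K b)) -> u =1 v.
Proof.
move=> uv g; rewrite [g](monalgE g) !linear_sum; apply: eq_bigr => b _.
have -> : << g@_b *g b >> = g@_b *: fbas K b :> fmod K B.
  rewrite /fbas -lock.
  by apply/malgP => b'; rewrite mcoeffZ !mcoeffU mulrnAr mulr1.
by rewrite !linearZZ uv.
Qed.
End FreeModule.

Section Tensor.
Variables (K : comNzRingType) (V W : lmodType K).

Definition tensor_ix : choiceType := (V * W)%type.

Definition pair_bas (v : V) (w : W) : fmod K tensor_ix := fbas K (v, w).

Variant tensor_rel : fmod K tensor_ix -> Prop :=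
| TensorL a v v' w : tensor_rel
    (pair_bas (a *: v + v') w - (a *: pair_bas v w + pair_bas v' w))
| TensorR a v w w' : tensor_rel
    (pair_bas v (a *: w + w') - (a *: pair_bas v w + pair_bas v w')).

Definition tensor : Type := lquot tensor_rel.
HB.instance Definition _ := GRing.Lmodule.on tensor.

Definition tens (v : V) (w : W) : tensor := lpi tensor_rel (pair_bas v w).

Lemma tens_linl w : linear (tens^~ w).
Proof.
move=> a v v'; have := lpi_rel (TensorL a v v' w).
by rewrite linearB /= [X in _ - X]linearP => /eqP; rewrite subr_eq0 => /eqP.
Qed.

Lemma tens_linr v : linear (tens v).
Proof.
move=> a w w'; have := lpi_rel (TensorR a v w w').
by rewrite linearB /= [X in _ - X]linearP => /eqP; rewrite subr_eq0 => /eqP.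
Qed.
End Tensor.

Notation "v \ox w" := (tens v w) (at level 40, left associativity) : ring_scope.

Section TensorMap.
Variables (K : comNzRingType) (V W V' W' : lmodType K).
Variables (f : {linear V -> V'}) (g : {linear W -> W'}).

Let fg : {linear fmod K (tensor_ix V W) -> tensor V' W'} :=
  lin_ext (fun p => f p.1 \ox g p.2).

Let fg_rel x : tensor_rel x -> fg x = 0.
Proof.
case=> *; rewrite linearB /= [X in _ - X]linearP /fg /= !lin_extU /=.
  by rewrite linearP tens_linl subrr.
by rewrite linearP tens_linr subrr.
Qed.

Definition tens_map : tensor V W -> tensor V' W' := lquot_lift fg.

Lemma tens_mapE v w : tens_map (v \ox w) = f v \ox g w.
Proof. by rewrite /tens_map (lquot_liftE fg_rel) /fg /= lin_extU. Qed.

Lemma tens_map_is_linear : linear tens_map.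
Proof. exact: (lquot_lift_is_linear fg_rel). Qed.

HB.instance Definition _ :=
  GRing.isLinear.Build K (tensor V W) (tensor V' W') _ tens_map
    tens_map_is_linear.
End TensorMap.

(* Modules presented by generators and relations: rel holds the defining
   relations of an associative algebra with generators I, and the module is
   the direct sum, over the labels l : Lam, of the cyclic modules with
   generator (hwv l) and defining relations ann l. *)
Section PresentedModule.
Variables (K : comNzRingType) (I Lam : choiceType).

Local Notation FA := {malg K[{fmonom I}]}.

Definition gen (i : I) : FA := << fmu i >>.

Variables (rel : FA -> Prop) (ann : Lam -> FA -> Prop).

Variant presented_rel : {malg FA[Lam]} -> Prop :=
| PresentedRel x b l : rel x -> presented_rel << x * b *g l >>
| PresentedAnn l x : ann l x -> presented_rel << x *g l >>.

Definition pmod : Type := lquot presented_rel.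
HB.instance Definition _ := GRing.Zmodule.on pmod.

Definition act (x : FA) (v : pmod) : pmod := x *: (v : lquot presented_rel).

Definition pmod_scale (c : K) (v : pmod) : pmod := act c%:MP v.

Lemma pmod_scaleA a b x : pmod_scale a (pmod_scale b x) = pmod_scale (a * b) x.
Proof. by rewrite /pmod_scale mpolyCM /act scalerA. Qed.
Lemma pmod_scale1 : left_id 1 pmod_scale.
Proof. by move=> x; rewrite /pmod_scale mpolyC1E /act scale1r. Qed.
Lemma pmod_scaleDr : right_distributive pmod_scale +%R.
Proof. by move=> a x y; rewrite /pmod_scale /act scalerDr. Qed.
Lemma pmod_scaleDl x : {morph pmod_scale^~ x : a b / a + b}.
Proof. by move=> a b; rewrite /pmod_scale /act monalgUD scalerDl. Qed.

HB.instance Definition _ := GRing.Zmodule_isLmodule.Build K pmod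
  pmod_scaleA pmod_scale1 pmod_scaleDr pmod_scaleDl.

Definition hwv (l : Lam) : pmod := lpi presented_rel << l >>.

Lemma actM x y v : act (x * y) v = act x (act y v).
Proof. by rewrite /act scalerA. Qed.

Lemma act_ann l x : ann l x -> act x (hwv l) = 0.
Proof.
move=> lx; rewrite /act /hwv -linearZ /= -[RHS](lpi_rel (PresentedAnn lx)).
congr lpi; apply/malgP => m.
by rewrite mcoeffZ !mcoeffU; case: eqP; rewrite ?mulr1 // mulr0.
Qed.

Lemma act_rel x v : rel x -> act x v = 0.
Proof.
move=> rx; rewrite /act -[v]lreprK -linearZ /=.
move: (lrepr _) => g; rewrite (monalgE g) scaler_sumr raddf_sum big1 // => l _.
rewrite -[RHS](lpi_rel (PresentedRel g@_l l rx)).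
congr lpi; apply/malgP => m.
by rewrite mcoeffZ !mcoeffU; case: eqP; rewrite ?mulr0.
Qed.
End PresentedModule.

(* The twisted N=2 superconformal algebra of central charge c, in the modes
   L(z) = sum L_n z^(-n-2), H(z) = sum H_n z^(-n-1), G(z) = sum G_n z^(-n-2),
   Q(z) = sum Q_n z^(-n-1): after the topological twist Q and G have conformal
   weights 1 and 2, and the Virasoro central term vanishes. *)
Variant n2gen := N2L of int | N2H of int | N2G of int | N2Q of int.

Definition n2gen_code (x : n2gen) : (int + int) + (int + int) :=
  match x with
  | N2L n => inl (inl n) | N2H n => inl (inr n)
  | N2G n => inr (inl n) | N2Q n => inr (inr n)
  end.
Definition n2gen_decode (x : (int + int) + (int + int)) : n2gen :=
  match x with
  | inl (inl n) => N2L n | inl (inr n) => N2H n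
  | inr (inl n) => N2G n | inr (inr n) => N2Q n
  end.
Lemma n2gen_codeK : cancel n2gen_code n2gen_decode. Proof. by case. Qed.
HB.instance Definition _ := Choice.copy n2gen (can_type n2gen_codeK).

Section N2.
Variable C : numFieldType.
Local Notation A := {malg C[{fmonom n2gen}]}.
Local Notation L n := (gen C (N2L n)).
Local Notation H n := (gen C (N2H n)).
Local Notation G n := (gen C (N2G n)).
Local Notation Q n := (gen C (N2Q n)).
Local Notation "[[ x , y ]]" := (x * y - y * x) (at level 0).
Local Notation "{{ x , y }}" := (x * y + y * x) (at level 0).
Local Notation kd m n := ((m + n == 0)%:R : C).

Variant n2_rel (c : C) : A -> Prop :=
| N2_LL m n : n2_rel c ([[L m, L n]] - (m - n)%:~R *: L (m + n))
| N2_HH m n : n2_rel c ([[H m, H n]] - (c / 3 * m%:~R * kd m n)%:A)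
| N2_LH m n : n2_rel c ([[L m, H n]]
    - ((- n)%:~R *: H (m + n) + (c / 6 * (m ^+ 2 + m)%:~R * kd m n)%:A))
| N2_LG m n : n2_rel c ([[L m, G n]] - (m - n)%:~R *: G (m + n))
| N2_LQ m n : n2_rel c ([[L m, Q n]] - (- n)%:~R *: Q (m + n))
| N2_HG m n : n2_rel c ([[H m, G n]] - G (m + n))
| N2_HQ m n : n2_rel c ([[H m, Q n]] + Q (m + n))
| N2_GQ m n : n2_rel c ({{G m, Q n}}
    - (2 *: L (m + n) - (2 * n)%:~R *: H (m + n)
       + (c / 3 * (m ^+ 2 + m)%:~R * kd m n)%:A))
| N2_GG m n : n2_rel c {{G m, G n}}
| N2_QQ m n : n2_rel c {{Q m, Q n}}.

(* Labels are pairs (U(1) charge h, dimension l). *)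
Variant n2_ann (hl : C * C) : A -> Prop :=
| N2ann_Q n : 1 <= n -> n2_ann hl (Q n)
| N2ann_G n : 0 <= n -> n2_ann hl (G n)
| N2ann_L n : 1 <= n -> n2_ann hl (L n)
| N2ann_H n : 1 <= n -> n2_ann hl (H n)
| N2ann_H0 : n2_ann hl (H 0 - hl.1%:A)
| N2ann_L0 : n2_ann hl (L 0 - hl.2%:A).

(* The direct sum of all Verma modules at central charge -3-6k, so that states
   of different weights live in one space. *)
Definition n2_mod (k : C) : Type := pmod (n2_rel (- 3 - 6 * k)) n2_ann.
HB.instance Definition _ (k : C) := GRing.Lmodule.on (n2_mod k).

Definition n2_hw (k h l : C) : n2_mod k := hwv (n2_rel (- 3 - 6 * k)) n2_ann (h, l).
End N2.

Variant fgen := Psi of int | PsiBar of int.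

Definition fgen_code (x : fgen) : int + int :=
  match x with Psi n => inl n | PsiBar n => inr n end.
Definition fgen_decode (x : int + int) : fgen :=
  match x with inl n => Psi n | inr n => PsiBar n end.
Lemma fgen_codeK : cancel fgen_code fgen_decode. Proof. by case. Qed.
HB.instance Definition _ := Choice.copy fgen (can_type fgen_codeK).

Section Fermions.
Variable C : numFieldType.
Local Notation A := {malg C[{fmonom fgen}]}.
Local Notation psi n := (gen C (Psi n)).
Local Notation psibar n := (gen C (PsiBar n)).
Local Notation "{{ x , y }}" := (x * y + y * x) (at level 0).

Variant ferm_rel : A -> Prop :=
| Ferm_PP m n : ferm_rel {{psi m, psi n}}
| Ferm_BB m n : ferm_rel {{psibar m, psibar n}}
| Ferm_PB m n : ferm_rel ({{psi m, psibar n}} - ((m + n == 0)%:R : C)%:A).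

Variant ferm_ann (l : unit) : A -> Prop :=
| Ferm_annP n : 1 <= n -> ferm_ann l (psi n)
| Ferm_annB n : 0 <= n -> ferm_ann l (psibar n).

Definition ferm_mod : Type := pmod ferm_rel ferm_ann.
HB.instance Definition _ := GRing.Lmodule.on ferm_mod.

Definition ferm_vac : ferm_mod := hwv ferm_rel ferm_ann tt.
End Fermions.

Variant boson := dF | dU.

Definition boson_code (x : boson) : bool := if x is dU then true else false.
Definition boson_decode (b : bool) : boson := if b then dU else dF.
Lemma boson_codeK : cancel boson_code boson_decode. Proof. by case. Qed.
HB.instance Definition _ := Choice.copy boson (can_type boson_codeK).

Definition osc_ix : choiceType := (boson * nat)%type.
Notation osc := {cmonom osc_ix}.

Definition add_osc (x : osc_ix) (o : osc) : osc := locked (mulcm o (ucm x)).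
Definition del_osc (x : osc_ix) (o : osc) : osc := locked (divcm o (ucm x)).

Lemma add_oscE x o y : add_osc x o y = (o y + (x == y))%N.
Proof. by rewrite /add_osc -lock mulcmE ucmE. Qed.
Lemma del_oscE x o y : del_osc x o y = (o y - (x == y))%N.
Proof. by rewrite /del_osc -lock divcmE ucmE. Qed.

(* The direct sum over a of the Fock modules generated from |e^{a(U-F)}>.  The
   basis vector (a, m) is the monomial m in the creation modes applied to
   |e^{a(U-F)}>, the variable (X, n) standing for the mode X_{-(n+1)}. *)
Section Fock.
Variable C : numFieldType.
Implicit Types (k a b : C) (X Y : boson) (o : osc).

Definition fock_ix : choiceType := (C * osc)%type.
Definition fock : lmodType C := fmod C fock_ix.

Definition fock_bas (a : C) (o : osc) : fock := fbas C ((a, o) : fock_ix).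

Definition fock_vac (a : C) : fock := fock_bas a (onecm _).

(* X(z)X(w) ~ boson_norm X / (z-w)^2 *)
Definition boson_norm (k : C) (X : boson) : C :=
  match X with dF => - k / 2 | dU => k / 2 end.

Definition mode_basis (k : C) (X : boson) (n : int) (b : fock_ix) : fock :=
  match n with
  | Posz 0 => (k * b.1 / 2) *: fock_bas b.1 b.2
  | Posz n'.+1 => (boson_norm k X * n'.+1%:R * (b.2 (X, n'))%:R) *:
                    fock_bas b.1 (del_osc (X, n') b.2)
  | Negz n' => fock_bas b.1 (add_osc (X, n') b.2)
  end.

Definition mode (k : C) (X : boson) (n : int) : fock -> fock :=
  lin_ext (mode_basis k X n).
HB.instance Definition _ k X n := GRing.Linear.on (mode k X n).

Lemma mode_neg k X n a o :
  mode k X (Negz n) (fock_bas a o) = fock_bas a (add_osc (X, n) o).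
Proof. exact: lin_extU. Qed.

Lemma mode_pos k X n a o :
  mode k X (Posz n.+1) (fock_bas a o) =
    (boson_norm k X * n.+1%:R * (o (X, n))%:R) *:
      fock_bas a (del_osc (X, n) o).
Proof. exact: lin_extU. Qed.

Lemma mode_zero k X a o :
  mode k X 0 (fock_bas a o) = (k * a / 2) *: fock_bas a o.
Proof. exact: lin_extU. Qed.

Lemma mode_vac_pos k X n a : 1 <= n -> mode k X n (fock_vac a) = 0.
Proof.
by case: n => [[|n]|n] //= _; rewrite /fock_vac mode_pos onecmE mulr0 scale0r.
Qed.

Lemma mode_vac0 k X a : mode k X 0 (fock_vac a) = (k * a / 2) *: fock_vac a.
Proof. exact: mode_zero. Qed.

Lemma mode_comm_posneg k X Y m n a o :
  mode k X (Posz m.+1) (mode k Y (Negz n) (fock_bas a o))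
    - mode k Y (Negz n) (mode k X (Posz m.+1) (fock_bas a o))
  = (boson_norm k X * m.+1%:R * ((X == Y) && (m == n))%:R) *: fock_bas a o.
Proof.
rewrite mode_neg [X in X - _]mode_pos mode_pos linearZ /= mode_neg add_oscE.
set x : osc_ix := (X, m); set y : osc_ix := (Y, n).
rewrite -[(X == Y) && _]/(x == y).
set c := boson_norm k X * m.+1%:R.
case: (eqVneq x y) => [e|ne].
  rewrite -e mulr1.
  have -> : del_osc x (add_osc x o) = o.
    by apply/eqP/cmP => i; rewrite del_oscE add_oscE addnK.
  have -> : (c * (o x)%:R) *: fock_bas a (add_osc x (del_osc x o))
    = (c * (o x)%:R) *: fock_bas a o.
    case: (posnP (o x)) => [->|o_gt0]; first by rewrite mulr0 !scale0r.
    congr (_ *: fock_bas _ _).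
    apply/eqP/cmP => i; rewrite add_oscE del_oscE.
    by case: eqP => [<-|_]; rewrite ?subnK // subn0 addn0.
  by rewrite -scalerBl -mulrBr natrD addrAC subrr add0r mulr1.
rewrite addn0 mulr0 scale0r.
suff -> : del_osc x (add_osc y o) = add_osc y (del_osc x o) by rewrite subrr.
apply/eqP/cmP => i; rewrite !(del_oscE, add_oscE).
case: eqP => [<-|_]; case: eqP => [ie|_]; rewrite ?addn0 ?subn0 //.
by rewrite ie eqxx in ne.
Qed.

Lemma mode_comm_pos k X Y m n a o :
  mode k X (Posz m.+1) (mode k Y (Posz n.+1) (fock_bas a o)) =
  mode k Y (Posz n.+1) (mode k X (Posz m.+1) (fock_bas a o)).
Proof.
rewrite [in LHS]mode_pos [in RHS]mode_pos !linearZ /= [in LHS]mode_pos [in RHS]mode_pos.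
rewrite !scalerA !del_oscE.
have [[-> ->]|ne] := eqVneq ((X, m) : osc_ix) (Y, n); first by reflexivity.
rewrite !subn0 mulrC; congr (_ *: fock_bas _ _).
by apply/eqP/cmP => i; rewrite !del_oscE subnAC.
Qed.

Lemma mode_comm_neg k X Y m n a o :
  mode k X (Negz m) (mode k Y (Negz n) (fock_bas a o)) =
  mode k Y (Negz n) (mode k X (Negz m) (fock_bas a o)).
Proof.
rewrite [in LHS]mode_neg [in RHS]mode_neg [in LHS]mode_neg [in RHS]mode_neg.
by congr fock_bas; apply/eqP/cmP => i; rewrite !add_oscE addnAC.
Qed.

Lemma mode0_comm k X Y n a o :
  mode k X 0 (mode k Y n (fock_bas a o)) = mode k Y n (mode k X 0 (fock_bas a o)).
Proof.
rewrite [in RHS]mode_zero linearZ /=.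
case: n => [[|n]|n].
- by rewrite mode_zero linearZ /= mode_zero.
- by rewrite mode_pos linearZ /= mode_zero !scalerA mulrC.
- by rewrite mode_neg mode_zero.
Qed.

Lemma mode_comm k X Y (m n : int) v :
  mode k X m (mode k Y n v) - mode k Y n (mode k X m v) =
    (boson_norm k X * m%:~R * ((X == Y) && (m + n == 0))%:R) *: v.
Proof.
pose f : {linear fock -> fock} :=
  (mode k X m \o mode k Y n) \- (mode k Y n \o mode k X m).
pose g : {linear fock -> fock} :=
  (boson_norm k X * m%:~R * ((X == Y) && (m + n == 0))%:R) \*: idfun.
suff fg : f =1 g by exact: (fg v).
apply: (@eq_linear_basis C _ _ f g) => -[a o]; rewrite /f /g /= {f g v}.
case: m n => [[|m]|m] [[|n]|n]; rewrite -/(fock_bas a o) ?andbF.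
- by rewrite mode0_comm subrr ?mulr0z ?mulr0 ?mul0r scale0r.
- by rewrite mode0_comm subrr ?mulr0z ?mulr0 ?mul0r scale0r.
- by rewrite mode0_comm subrr ?mulr0z ?mulr0 ?mul0r scale0r.
- by rewrite -mode0_comm subrr ?andbF mulr0 scale0r.
- by rewrite mode_comm_pos subrr ?andbF mulr0 scale0r.
- rewrite mode_comm_posneg; congr ((_ * (_ && _)%:R) *: _).
  by rewrite NegzE subr_eq0.
- by rewrite -mode0_comm subrr ?andbF mulr0 scale0r.
- rewrite -opprB mode_comm_posneg -scaleNr NegzE mulrNz mulrN mulNr; congr (_ *: _); congr (- _).
  rewrite addrC subr_eq0 eqz_nat eqSS [Y == X]eq_sym.
  have [->|_] := eqVneq X Y; last by rewrite !mulr0.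
  by have [->|_] := eqVneq n m; rewrite ?mulr0.
- by rewrite mode_comm_neg subrr ?andbF mulr0 scale0r.
Qed.
Definition UmF_mode (k : C) (n : int) (v : fock) : fock :=
  mode k dU n v - mode k dF n v.

Lemma UmF_mode0 k v : UmF_mode k 0 v = 0.
Proof.
suff E : mode k dU 0 =1 mode k dF 0 by rewrite /UmF_mode E subrr.
apply: (@eq_linear_basis C _ _ (mode k dU 0) (mode k dF 0)) => -[a o].
by rewrite /= -/(fock_bas a o) !mode_zero.
Qed.

Definition charge_shift (b : C) : fock -> fock :=
  lin_ext (fun x : fock_ix => fock_bas (x.1 + b) x.2).

(* The coefficient of z^m in exp (sum_(n >= 1) x_n z^n), for commuting
   operators x_n. *)
Definition exp_coef (x : nat -> fock -> fock) (m : nat) (v : fock) : fock :=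
  \sum_(j < m.+1) (j`!%:R)^-1 *:
    \sum_(t : j.-tuple 'I_m.+1 | all (fun i : 'I_m.+1 => 0 < i)%N t
                                 && (\sum_(i <- t) (i : nat) == m)%N)
      foldr (fun (i : 'I_m.+1) w => x i w) v t.

(* The coefficient of z^s in
     e^{b(U-F)}(z) = e^{bq} z^{b(U-F)_0}
                     exp (b sum_(n >= 1) (U-F)_{-n} z^n / n)
                     exp (- b sum_(n >= 1) (U-F)_n z^{-n} / n),
   where e^{bq} is the charge shift.  The factor z^{b(U-F)_0} is 1, because
   (U-F)_0 = 0 on every module considered (UmF_mode0). *)
Definition vertex_basis (k b : C) (s : int) (x : fock_ix) : fock :=
  \sum_(i \in [set: nat])
    match s + Posz i with
    | Posz j => charge_shift b
        (exp_coef (fun n => *:%R (b / n%:R) \o UmF_mode k (- Posz n)) j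
          (exp_coef (fun n => *:%R (- b / n%:R) \o UmF_mode k n) i (fock_bas x.1 x.2)))
    | Negz _ => 0
    end.

Definition vertex (k b : C) (s : int) : fock -> fock :=
  lin_ext (vertex_basis k b s).
HB.instance Definition _ k b s := GRing.Linear.on (vertex k b s).

(* E^{12}(z) = sum_n E^{12}_n z^{-n-1} *)
Definition E12_fock (k : C) (n : int) : fock -> fock :=
  vertex k (2 / k) (- n - 1).
HB.instance Definition _ k n := GRing.Linear.on (E12_fock k n).
End Fock.

Section Realization.
Variable C : numFieldType.

Definition states (k : C) : Type :=
  tensor (n2_mod k) (tensor (fock C) (ferm_mod C)).
HB.instance Definition _ k := GRing.Lmodule.on (states k).

Definition E12 (k : C) (n : int) : states k -> states k :=
  tens_map idfun (tens_map (E12_fock k n) idfun).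

Definition ramond_hw (k p j : C) : states k :=
  let l := - ((j + p - k / 2) * (1 - j + k / 2 + p)) / (1 + k) in
  n2_hw k (k - 2 * p) l \ox (fock_vac (2 * j / k) \ox ferm_vac C).

Definition MFF_minus_R (k p : C) (r : nat) : states k :=
  iter r (@E12 k (-1)) (ramond_hw k p (- (r%:R / 2) + (k + 1) / 2)).
End Realization.
Arguments E12 {C} k n _.
Arguments MFF_minus_R {C} k p r.

(* Main.v *)
(* No positive mode survives on a Fock vacuum, so on it the z^0 coefficient of
   e^{(2/k)(U-F)}(z) reduces to the charge shift; applied r times, E^{12}_{-1}
   raises the momentum 2j/k to 2(j+r)/k = (r+k+1)/k. *)
Require Import Defs.
From mathcomp Require Import all_boot all_order all_algebra.
From mathcomp Require Import classical_sets fsbigop.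
From mathcomp Require Import reals complex.
From mathcomp Require Import ring.
Import GRing.Theory Num.Theory.
Local Open Scope ring_scope.

(** Only [j = 0] occurs, and its single term is the empty product. *)
Lemma exp_coef0 (C : numFieldType) (x : nat -> fock C -> fock C) v :
  exp_coef x 0 v = v.
Proof.
rewrite /exp_coef big_ord1 fact0 invr1 scale1r (big_pred1 [tuple]) //= => t.
by rewrite (tuple0 t) [LHS]/= big_nil; apply/esym/eqP.
Qed.

(** Each term of positive degree is a nonempty product of operators of positive index: the innermost
    one kills [v], and the others preserve [0]. *)
Lemma exp_coef_annihilated (C : numFieldType) (x : nat -> fock C -> fock C) m v :
    (forall i, x i 0 = 0) -> (forall i, (0 < i)%N -> x i v = 0) ->
  (0 < m)%N -> exp_coef x m v = 0.
Proof.
move=> x0 xv m_gt0; rewrite /exp_coef big1 // => j _.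
rewrite big1 ?scaler0 // => t /andP[t_gt0 /eqP t_sum].
(* The empty tuple has sum 0, which [m_gt0] excludes. *)
case: (tval t) t_gt0 t_sum => [|i s].
  by rewrite big_nil => _ m0; rewrite -m0 in m_gt0.
move=> + _; elim: s i => [|i' s IHs] i /=; first by rewrite andbT; exact: xv.
by case/andP=> _ /IHs /= ->.
Qed.

Lemma UmF_mode_0 (C : numFieldType) (k : C) (n : int) : UmF_mode k n 0 = 0.
Proof. by rewrite /UmF_mode !linear0 addr0. Qed.

Lemma UmF_mode_vac_pos (C : numFieldType) (k a : C) (n : nat) :
  (0 < n)%N -> UmF_mode k n (fock_vac a) = 0.
Proof. by move=> n_gt0; rewrite /UmF_mode !mode_vac_pos // subrr. Qed.

Lemma charge_shift_vac (C : numFieldType) (b a : C) :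
  charge_shift b (fock_vac a) = fock_vac (a + b).
Proof. exact: lin_extU. Qed.

Lemma charge_shift_0 (C : numFieldType) (b : C) : charge_shift b 0 = 0.
Proof. exact: linear0. Qed.

(** Needed for the creation exponential, which acts on whatever the annihilation exponential
    returns. *)
Lemma exp_coef_UmF_0 (C : numFieldType) (k : C) (c : nat -> C)
    (s : nat -> int) m :
  exp_coef (fun n => *:%R (c n) \o UmF_mode k (s n)) m 0 = 0.
Proof.
case: m => [|m]; first by rewrite exp_coef0.
by apply: exp_coef_annihilated => // n *; rewrite /= UmF_mode_0 scaler0.
Qed.

Lemma exp_coef_UmF_vac (C : numFieldType) (k a : C) (c : nat -> C) m :
  (0 < m)%N ->
  exp_coef (fun n => *:%R (c n) \o UmF_mode k (Posz n)) m (fock_vac a) = 0.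
Proof.
apply: exp_coef_annihilated => n; first by rewrite /= UmF_mode_0 scaler0.
by move=> n_gt0; rewrite /= UmF_mode_vac_pos ?scaler0.
Qed.

Lemma vertex0_vac (C : numFieldType) (k b a : C) :
  vertex k b 0 (fock_vac a) = fock_vac (a + b).
Proof.
rewrite /vertex lin_extU /vertex_basis -[fock_bas _ _]/(fock_vac a).
(* For [i > 0] the annihilation exponential contributes its degree [i] coefficient, which vanishes
   on the vacuum; only [i = 0] survives. *)
rewrite -(fsbig_widen [set 0%N]) //.
  by rewrite fsbig_set1 addn0 !exp_coef0 charge_shift_vac.
move=> i [_ i_neq0]; have i_gt0 : (0 < i)%N by rewrite lt0n; apply/eqP.
rewrite /preimage /set1 /mkset.
rewrite [X in exp_coef _ _ X](exp_coef_UmF_vac _ _ _ _ _ i_gt0).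
by rewrite exp_coef_UmF_0 charge_shift_0.
Qed.

Lemma E12_tens (C : numFieldType) (k : C) n v f w :
  E12 k n (v \ox (f \ox w)) = v \ox (E12_fock k n f \ox w).
Proof.
rewrite /E12 tens_mapE; apply: (congr1 (tens v)).
exact: (tens_mapE (E12_fock k n) idfun).
Qed.

(** At [n = -1] the power [- n - 1] of [z] computes to [0]. *)
Lemma E12_fock_vac (C : numFieldType) (k a : C) :
  E12_fock k (-1) (fock_vac a) = fock_vac (a + 2 / k).
Proof. exact: vertex0_vac. Qed.

Lemma E12_iter_vac (C : numFieldType) (k a : C) v w r :
  iter r (E12 k (-1)) (v \ox (fock_vac a \ox w)) =
    v \ox (fock_vac (a + r%:R * (2 / k)) \ox w).
Proof.
elim: r => [|r IHr]; first by rewrite mul0r addr0.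
have -> : a + r.+1%:R * (2 / k) = a + r%:R * (2 / k) + 2 / k.
  by rewrite -addrA -natr1 mulrDl mul1r.
(* Not [by]: its attempt to close the goal with IHr makes unification diverge. *)
rewrite iterS IHr E12_tens E12_fock_vac; reflexivity.
Qed.

Theorem theorem5p4 (R : realType) (k p : R[i]) (r : nat)
    (k_neq0 : k != 0) (k_neqN1 : k != -1) (r_ge1 : (1 <= r)%N) :
  MFF_minus_R k p r =
    n2_hw k (k - 2 * p)
      (1 / (k + 1) * ((r%:R - 1) / 2 - p) * ((r%:R + 1) / 2 + p))
    \ox (fock_vac ((r%:R + k + 1) / k) \ox ferm_vac R[i]).
Proof.
have k1_neq0 : k + 1 != 0 by rewrite addr_eq0.
rewrite /MFF_minus_R /ramond_hw E12_iter_vac; set h := (_ / (1 + k)).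
(* Since [j - k / 2 = (1 - r) / 2], the factors of the numerator are [p - (r - 1) / 2] and
   [(r + 1) / 2 + p]; the overall minus sign flips the first. *)
have -> : h = 1 / (k + 1) * ((r%:R - 1) / 2 - p) * ((r%:R + 1) / 2 + p).
  by rewrite /h [1 + k]addrC; field.
(* The initial [2 * j = k + 1 - r] gains [2 * r] from the [r] shifts. *)
set a := (X in fock_vac X); have -> // : a = (r%:R + k + 1) / k.
by rewrite /a; field.
Qed.
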